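(* There exists a countable simple rank $3$ $\wedge$-matroid $M_*$ which is homogeneous (every isomorphism between finitely generated substructures of $M_*$ extends to an automorphism of $M_*$) and universal for the class of finite simple $\wedge$-matroids of rank $\leq 3$, i.e. every finite simple $\wedge$-matroid of rank $\leq 3$ embeds into $M_*$.
   Context: A simple matroid of rank $\leq 3$ is a $3$-hypergraph $(V,R)$ ($R$ a ternary relation) with $R$ irreflexive (only holds on triples of pairwise distinct elements) and symmetric (invariant under permuting arguments), satisfying the exchange axiom: if $R(a,b,c)$ and $R(a,b,d)$ then every $3$-element subset of $\{a,b,c,d\}$ is in $R$. It has rank $3$ if there are three pairwise distinct points $a,b,c$ with $\neg R(a,b,c)$. Such a matroid corresponds to a linear space whose points are the elements of $V$ and whose lines are the sets $a\vee b:=\{a,b\}\cup\{c: R(a,b,c)\}$ for $a\neq b$. A simple $\wedge$-matroid of rank $\leq 3$ is a structure $(V,R,\wedge)$ where $(V,R)$ is a simple matroid of rank $\leq 3$ and $\wedge$ is the $4$-ary function defined by: $\wedge(a,b,c,d)=p$ if $a\neq b$, $c\neq d$, the lines $a\vee b$ and $c\vee d$ are distinct and meet in a point $p\notin\{a,b,c,d\}$; and $\wedge(a,b,c,d)=a$ otherwise. Substructures and embeddings are taken in the language $\{R,\wedge\}$: a substructure is a subset closed under $\wedge$ with the induced relation and function, and an embedding is an injective map preserving $R$, its negation, and $\wedge$. *)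

(* Defs.v *)
From mathcomp Require Import all_boot.
From mathcomp Require Import boolp classical_sets functions cardinality.

Set Implicit Arguments.
Unset Strict Implicit.
Unset Printing Implicit Defensive.

Local Open Scope classical_set_scope.

Definition distinct3 (V : Type) (a b c : V) : Prop :=
  [/\ a <> b, a <> c & b <> c].

Record simple_matroid (V : Type) (R : V -> V -> V -> Prop) : Prop := {
  matroid_irr : forall a b c, R a b c -> distinct3 a b c;
  matroid_sym : forall a b c, R a b c ->
    [/\ R a c b, R b a c, R b c a, R c a b & R c b a];
  matroid_exchange : forall a b c d, R a b c -> R a b d ->
    forall x y z, [set a; b; c; d] x -> [set a; b; c; d] y ->
      [set a; b; c; d] z -> distinct3 x y z -> R x y z
}.

Definition line (V : Type) (R : V -> V -> V -> Prop) (a b : V) : set V :=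
  [set a; b] `|` [set c | R a b c].

Definition lines_meet_at (V : Type) (R : V -> V -> V -> Prop)
    (a b c d p : V) : Prop :=
  [/\ a <> b, c <> d, line R a b <> line R c d,
      line R a b `&` line R c d = [set p] & ~ [set a; b; c; d] p].

Record wedge_spec (V : Type) (R : V -> V -> V -> Prop)
    (w : V -> V -> V -> V -> V) : Prop := {
  wedge_meet : forall a b c d p, lines_meet_at R a b c d p -> w a b c d = p;
  wedge_default : forall a b c d,
    ~ (exists p, lines_meet_at R a b c d p) -> w a b c d = a
}.

(* Simple wedge-matroids of rank at most 3 (the carrier may be empty). *)
Record wmatroid := WMatroid {
  mpoint :> Type;
  mrel : mpoint -> mpoint -> mpoint -> Prop;
  mwedge : mpoint -> mpoint -> mpoint -> mpoint -> mpoint;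
  mrelP : simple_matroid mrel;
  mwedgeP : wedge_spec mrel mwedge
}.

Definition rank3 (M : wmatroid) : Prop :=
  exists a b c : M, distinct3 a b c /\ ~ mrel a b c.

Definition substructure (M : wmatroid) (A : set M) : Prop :=
  forall a b c d, A a -> A b -> A c -> A d -> A (mwedge a b c d).

Definition finitely_generated (M : wmatroid) (A : set M) : Prop :=
  exists S : set M, finite_set S /\ A = smallest (@substructure M) S.

Definition preserves_on (M N : wmatroid) (A : set M) (f : M -> N) : Prop :=
  (forall a b c, A a -> A b -> A c ->
     (mrel a b c <-> mrel (f a) (f b) (f c))) /\
  (forall a b c d, A a -> A b -> A c -> A d ->
     f (mwedge a b c d) = mwedge (f a) (f b) (f c) (f d)).

Definition embedding (M N : wmatroid) (f : M -> N) : Prop :=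
  injective f /\ preserves_on setT f.

(* For substructures A and B, only the values of f on A are relevant: f stands
   for its restriction A -> B. *)
Definition isomorphism_on (M N : wmatroid) (A : set M) (B : set N)
    (f : M -> N) : Prop :=
  set_bij A B f /\ preserves_on A f.

Definition automorphism (M : wmatroid) (g : M -> M) : Prop :=
  isomorphism_on setT setT g.

Definition homogeneous (M : wmatroid) : Prop :=
  forall (A B : set M) (f : M -> M),
    finitely_generated A -> finitely_generated B -> isomorphism_on A B f ->
    exists g : M -> M, automorphism g /\ forall x, A x -> g x = f x.

Definition universal_for_finite (M : wmatroid) : Prop :=
  forall N : wmatroid, finite_set [set: N] ->
    exists f : N -> M, embedding f.

(* Main.v *)
(**
The limit is built from finite structures by free amalgamation. Since [mwedge]
is determined by [mrel], embeddings are the injections that preserve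
collinearity both ways and have a meet-closed image: whenever two distinct
lines spanned by points of the image meet, they meet inside it. Two structures
that share a meet-closed part A are amalgamated by fusing, for each pair of
points of A, the two lines they span, and by keeping all the other lines; as A
is meet-closed, two fused lines never meet outside A, so no further
identification is forced and both factors stay meet-closed.

The limit lives on [nat]: at stage n only an initial segment carries
collinearities, it stays meet-closed forever, and every finite extension
problem over it is eventually solved. The limit is therefore locally finite, so
finitely generated substructures are finite, and homogeneity follows by back
and forth.
*)
Require Import Defs.
From mathcomp Require Import all_boot.
From mathcomp Require Import boolp classical_sets functions cardinality.

Set Implicit Arguments.
Unset Strict Implicit.
Unset Printing Implicit Defensive.

Local Open Scope classical_set_scope.

(** * Collinearity and meet-closed sets *)

(** Collinearity with degenerate triples allowed: for [a <> b], [coll R a b] is the line through [a]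
    and [b], and a triple with a repetition is always collinear. *)
Definition coll (V : Type) (R : V -> V -> V -> Prop) (x y z : V) : Prop :=
  [\/ x = y, x = z, y = z | R x y z].

(** Stated contrapositively and without the wedge, so that it applies to bare relations: two spanned
    lines sharing a point outside [A] must be the same line. *)
Definition meet_closed (V : Type) (R : V -> V -> V -> Prop) (A : set V) : Prop :=
  forall a b c d x, A a -> A b -> A c -> A d -> a <> b -> c <> d ->
    coll R a b x -> coll R c d x -> ~ A x -> coll R a b c /\ coll R a b d.

(** Two transpositions generate all permutations of a triple. The exchange rule, used once as it
    stands and once with [a] and [b] interchanged, yields the two missing triples of a four-point
    set. *)
Lemma simple_matroid_intro (V : Type) (R : V -> V -> V -> Prop) :
  (forall a b c, R a b c -> distinct3 a b c) ->
  (forall a b c, R a b c -> R b a c) ->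
  (forall a b c, R a b c -> R a c b) ->
  (forall a b c d, R a b c -> R a b d -> c <> d -> R a c d) ->
  simple_matroid R.
Proof.
move=> irr s12 s23 exch.
have sym a b c : R a b c -> [/\ R a c b, R b a c, R b c a, R c a b & R c b a].
  by move=> r; split; eauto.
split=> // a b c d rc rd.
have full a1 b1 c1 : R a1 b1 c1 -> forall x y z,
    [set a1; b1; c1] x -> [set a1; b1; c1] y -> [set a1; b1; c1] z ->
    distinct3 x y z -> R x y z.
  move=> r; have [? ? ? ? ?] := sym _ _ _ r.
  by move=> x y z /= [[]|] -> [[]|] -> [[]|] -> [].
have [<-|ncd] := EM (c = d).
  have e x : [set a; b; c; c] x -> [set a; b; c] x.
    by move=> [|->]; [|right].
  by move=> x y z /e ? /e ? /e ?; exact: full rc _ _ _ _ _ _.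
have [? ? ? ? ?] := sym _ _ _ rc; have [? ? ? ? ?] := sym _ _ _ rd.
have racd := exch _ _ _ _ rc rd ncd.
have rbcd : R b c d by apply: (exch b a) ncd; exact: s12.
have [? ? ? ? ?] := sym _ _ _ racd; have [? ? ? ? ?] := sym _ _ _ rbcd.
by move=> x y z /= [[[]|]|] -> [[[]|]|] -> [[[]|]|] -> [].
Qed.

Section Collinearity.
Variables (V : Type) (R : V -> V -> V -> Prop).
Hypothesis MR : simple_matroid R.

Lemma coll12 x y z : coll R x y z -> coll R y x z.
Proof.
case=> [->|->|->|/(matroid_sym MR)[*]]; [exact: Or41|exact: Or43|exact: Or42|].
exact: Or44.
Qed.

Lemma coll_rel x y z : coll R x y z -> distinct3 x y z -> R x y z.
Proof. by case=> [->|->|->|//] []. Qed.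

Lemma rel_coll x y z : R x y z -> coll R x y z.
Proof. exact: Or44. Qed.

Lemma coll_exchange a b c d :
  a <> b -> coll R a b c -> coll R a b d -> coll R a c d.
Proof.
move=> nab [//|->|->|rc] cd; [exact: Or41|by []|].
have [->|nac] := EM (a = c); first exact: Or41.
have [->|nad] := EM (a = d); first exact: Or42.
have [->|ncd] := EM (c = d); first exact: Or43.
case: cd => [//|//|<-|rd].
  by have [? ? ? ? ?] := matroid_sym MR rc; exact: Or44.
apply: Or44; apply: (matroid_exchange MR rc rd); rewrite /=; try by split.
- by left; left; left.
- by left; right.
- by right.
Qed.

Lemma coll_span a b x y z : a <> b ->
  coll R a b x -> coll R a b y -> coll R a b z -> coll R x y z.
Proof.
move=> nab cx cy cz.
have [e|nax] := EM (a = x); first by rewrite -e; exact: coll_exchange nab cy cz.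
(* The base [a], [b] of the line is replaced by [x], [a], which brings [x] to the front. *)
apply: (@coll_exchange x a); first by move/esym.
  by apply: coll12; exact: coll_exchange nab cx cy.
by apply: coll12; exact: coll_exchange nab cx cz.
Qed.

Lemma coll_l a b : coll R a b a. Proof. exact: Or42. Qed.
Lemma coll_r a b : coll R a b b. Proof. exact: Or43. Qed.

Lemma coll_span_sym a b x y z : a <> b -> x <> y ->
  coll R a b x -> coll R a b y -> coll R x y z -> coll R a b z.
Proof.
move=> nab nxy cx cy cz; apply: coll_span nxy _ _ cz.
  by apply: coll_span nab cx cy _; exact: coll_l.
by apply: coll_span nab cx cy _; exact: coll_r.
Qed.

End Collinearity.

(** * Free amalgamation over a meet-closed part *)

Section Amalgam.
Variable V : Type.

Record amalgam_data (P Q : set V) (R1 R2 : V -> V -> V -> Prop) : Prop := {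
  am_matroid1 : simple_matroid R1;
  am_matroid2 : simple_matroid R2;
  am_supp1 : forall x y z, R1 x y z -> P z;
  am_supp2 : forall x y z, R2 x y z -> Q z;
  am_agree : forall x y z, (P `&` Q) x -> (P `&` Q) y -> (P `&` Q) z ->
    (R1 x y z <-> R2 x y z);
  am_closed1 : meet_closed R1 (P `&` Q);
  am_closed2 : meet_closed R2 (P `&` Q)
}.

Definition joined_line (R1 R2 : V -> V -> V -> Prop) (a b x : V) : Prop :=
  coll R1 a b x \/ coll R2 a b x.

Definition on_joined_line (A : set V) (R1 R2 : V -> V -> V -> Prop)
    (x y z : V) : Prop :=
  exists a b, [/\ A a, A b & a <> b] /\ [/\ joined_line R1 R2 a b x,
    joined_line R1 R2 a b y & joined_line R1 R2 a b z].

(** The third clause is the only source of triples belonging to neither factor; it makes each fused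
    line collinear as a whole. *)
Definition amalgam (A : set V) (R1 R2 : V -> V -> V -> Prop)
    (x y z : V) : Prop :=
  [\/ R1 x y z, R2 x y z | distinct3 x y z /\ on_joined_line A R1 R2 x y z].

Lemma amalgam_data_sym P Q R1 R2 :
  amalgam_data P Q R1 R2 -> amalgam_data Q P R2 R1.
Proof.
move=> [*]; split=> //; try by rewrite setIC.
by rewrite setIC => x y z *; apply: iff_sym; auto.
Qed.

Lemma joined_lineC R1 R2 a b x :
  joined_line R1 R2 a b x -> joined_line R2 R1 a b x.
Proof. by case=> ?; [right|left]. Qed.

Lemma amalgamC A R1 R2 x y z : amalgam A R1 R2 x y z -> amalgam A R2 R1 x y z.
Proof.
case=> [?|?|[d [a [b [h [? ? ?]]]]]]; [exact: Or32|exact: Or31|apply: Or33].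
by split=> //; exists a, b; split=> //; split; exact: joined_lineC.
Qed.

(** Fusing adds nothing on the [P] side: a point of [P] supplied by [R2] also lies in [Q], hence in
    the shared part, where the relations agree. *)
Lemma joined_line1 P Q R1 R2 a b x : amalgam_data P Q R1 R2 ->
  (P `&` Q) a -> (P `&` Q) b -> P x ->
  joined_line R1 R2 a b x -> coll R1 a b x.
Proof.
move=> D Aa Ab Px [//|[->|->|->|r]]; [exact: Or41|exact: Or42|exact: Or43|].
have Qx := am_supp2 D r.
by apply: Or44; apply/(am_agree D).
Qed.

Lemma joined_line_supp P Q R1 R2 a b x : amalgam_data P Q R1 R2 ->
  (P `&` Q) a -> (P `&` Q) b -> a <> b ->
  joined_line R1 R2 a b x -> P x \/ Q x.
Proof.
move=> D [Pa Qa] [Pb Qb] nab.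
case=> -[//|<-|<-|r]; try by left.
  by left; exact: (am_supp1 D r).
by right; exact: (am_supp2 D r).
Qed.

(** The points [c] and [d] belong to both factors, so in each factor separately they span the line
    through [a] and [b]. *)
Lemma joined_line_trans P Q R1 R2 a b c d x : amalgam_data P Q R1 R2 ->
  (P `&` Q) a -> (P `&` Q) b -> (P `&` Q) c -> (P `&` Q) d ->
  a <> b -> c <> d ->
  joined_line R1 R2 a b c -> joined_line R1 R2 a b d ->
  joined_line R1 R2 c d x -> joined_line R1 R2 a b x.
Proof.
move=> D Aa Ab Ac Ad nab ncd jc jd [] h; [left|right].
  apply: coll_span_sym h => //; first exact: am_matroid1 D.
    by apply: joined_line1 D _ _ _ jc => //; case: Ac.
  by apply: joined_line1 D _ _ _ jd => //; case: Ad.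
have D' := amalgam_data_sym D.
move: Aa Ab Ac Ad; rewrite setIC => Aa Ab Ac Ad.
apply: coll_span_sym h => //; first exact: am_matroid2 D.
  by apply: joined_line1 D' _ _ _ (joined_lineC jc) => //; case: Ac.
by apply: joined_line1 D' _ _ _ (joined_lineC jd) => //; case: Ad.
Qed.

(** Here meet-closedness of the shared part enters: [x] lies in [P] or in [Q], and in that factor
    two lines spanned by shared points meet outside the shared part, so they coincide. *)
Lemma joined_line_meet P Q R1 R2 a b c d x : amalgam_data P Q R1 R2 ->
  (P `&` Q) a -> (P `&` Q) b -> (P `&` Q) c -> (P `&` Q) d ->
  a <> b -> c <> d ->
  joined_line R1 R2 a b x -> joined_line R1 R2 c d x -> ~ (P `&` Q) x ->
  joined_line R1 R2 a b c /\ joined_line R1 R2 a b d.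
Proof.
move=> D Aa Ab Ac Ad nab ncd jx jx' nA.
have [Px|Qx] := joined_line_supp D Aa Ab nab jx.
  have [] := am_closed1 D Aa Ab Ac Ad nab ncd
    (joined_line1 D Aa Ab Px jx) (joined_line1 D Ac Ad Px jx') nA.
  by split; left.
have D' := amalgam_data_sym D.
move: (Aa) (Ab) (Ac) (Ad); rewrite setIC => Ba Bb Bc Bd.
have [] := am_closed2 D Aa Ab Ac Ad nab ncd
    (joined_line1 D' Ba Bb Qx (joined_lineC jx))
    (joined_line1 D' Bc Bd Qx (joined_lineC jx')) nA.
by split; right.
Qed.

Lemma joined_line_span P Q R1 R2 a b x y z : amalgam_data P Q R1 R2 ->
  (P `&` Q) a -> (P `&` Q) b -> a <> b -> x <> y ->
  joined_line R1 R2 a b x -> joined_line R1 R2 a b y ->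
  coll (amalgam (P `&` Q) R1 R2) x y z -> joined_line R1 R2 a b z.
Proof.
move=> D Aa Ab nab nxy jx jy; case=> [//|<-//|<-//|].
(* Stated for arbitrary data, so that exchanging the factors also covers triples of [R2]. *)
have side P' Q' R1' R2' : amalgam_data P' Q' R1' R2' ->
    (P' `&` Q') a -> (P' `&` Q') b -> joined_line R1' R2' a b x ->
    joined_line R1' R2' a b y -> R1' x y z -> joined_line R1' R2' a b z.
  move=> D' Aa' Ab' jx' jy' r; left.
  have M1 := am_matroid1 D'.
  have [ryx _ _ rzx _] := matroid_sym M1 r; have [_ _ ryz _ _] := matroid_sym M1 r.
  have Px : P' x by exact: (am_supp1 D' ryz).
  have Py : P' y by exact: (am_supp1 D' ryx).
  apply: (coll_span_sym M1 nab nxy) (rel_coll r).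
    exact: joined_line1 D' _ _ _ jx'.
  exact: joined_line1 D' _ _ _ jy'.
case=> [r|r|[_ [c [d [[Ac Ad ncd] [jx' jy' jz']]]]]].
- exact: side D _ _ _ _ r.
- apply: joined_lineC; apply: side (amalgam_data_sym D) _ _ _ _ r;
    by [rewrite setIC|exact: joined_lineC].
have [jc jd] : joined_line R1 R2 a b c /\ joined_line R1 R2 a b d; last first.
  exact: (joined_line_trans D Aa Ab Ac Ad nab ncd jc jd jz').
(* If [x] or [y] is not shared, the two fused lines meet outside the shared part. If both are
   shared, the two lines already have two distinct points in common within [R1]. *)
have [Ax|nAx] := EM ((P `&` Q) x); 
  last exact: (joined_line_meet D Aa Ab Ac Ad nab ncd jx jx' nAx).
have [Ay|nAy] := EM ((P `&` Q) y); 
  last exact: (joined_line_meet D Aa Ab Ac Ad nab ncd jy jy' nAy).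
have [Px _] := Ax; have [Py _] := Ay.
have M1 := am_matroid1 D.
have cx' := joined_line1 D Ac Ad Px jx'; have cy' := joined_line1 D Ac Ad Py jy'.
have cx := joined_line1 D Aa Ab Px jx; have cy := joined_line1 D Aa Ab Py jy.
split; left; apply: (coll_span_sym M1 nab nxy cx cy).
  exact: (coll_span M1 ncd cx' cy' (coll_l _ _ _)).
exact: (coll_span M1 ncd cx' cy' (coll_r _ _ _)).
Qed.

(** Exchange is decided by the origin of the two triples on [a], [b]. Triples of one factor use the
    exchange there; triples of different factors make [a] and [b] shared, so these span a fused
    line; and if one triple is on a fused line, [joined_line_span] puts the other on it. *)
Lemma amalgam_matroid P Q R1 R2 : amalgam_data P Q R1 R2 ->
  simple_matroid (amalgam (P `&` Q) R1 R2).
Proof.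
move=> D; have M1 := am_matroid1 D; have M2 := am_matroid2 D.
have irr a b c : amalgam (P `&` Q) R1 R2 a b c -> distinct3 a b c.
  by case=> [/(matroid_irr M1)|/(matroid_irr M2)|[]].
have s12 a b c : amalgam (P `&` Q) R1 R2 a b c -> amalgam (P `&` Q) R1 R2 b a c.
  case=> [/(matroid_sym M1)[*]|/(matroid_sym M2)[*]|]; [exact: Or31|exact: Or32|].
  move=> [[? ? ?] [u [v [h [? ? ?]]]]]; apply: Or33; split; last by exists u, v.
  by split=> // /esym.
apply: simple_matroid_intro => //.
- move=> a b c.
  case=> [/(matroid_sym M1)[*]|/(matroid_sym M2)[*]|]; [exact: Or31|exact: Or32|].
  move=> [[? ? ?] [u [v [h [? ? ?]]]]]; apply: Or33; split; last by exists u, v.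
  by split=> // /esym.
move=> a b c d rc rd ncd.
have [nab nac nbc] := irr _ _ _ rc; have [_ nad _] := irr _ _ _ rd.
have dis : distinct3 a c d by [].
have joined e f : amalgam (P `&` Q) R1 R2 a b f ->
    on_joined_line (P `&` Q) R1 R2 a b e ->
    on_joined_line (P `&` Q) R1 R2 a e f.
  move=> rf [u [v [[Au Av nuv] [ja jb je]]]]; exists u, v; split=> //; split=> //.
  by apply: (joined_line_span D Au Av nuv nab ja jb (rel_coll rf)).
have mixed e f : R1 a b e -> R2 a b f -> on_joined_line (P `&` Q) R1 R2 a e f.
  move=> re rf.
  have [r1 _ r2 _ _] := matroid_sym M1 re; have [r3 _ r4 _ _] := matroid_sym M2 rf.
  have Aa : (P `&` Q) a.
    by split; [exact: (am_supp1 D r2)|exact: (am_supp2 D r4)].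
  have Ab : (P `&` Q) b.
    by split; [exact: (am_supp1 D r1)|exact: (am_supp2 D r3)].
  exists a, b; split=> //; split; [|by left; exact: rel_coll|].
    by left; exact: coll_l.
  by right; exact: rel_coll.
have flip e f : on_joined_line (P `&` Q) R1 R2 a e f ->
    on_joined_line (P `&` Q) R1 R2 a f e.
  by move=> [u [v [h [? ? ?]]]]; exists u, v.
case: (rc) => [r1|r1|[_ j]]; last by apply: Or33; split=> //; exact: joined.
- case: (rd) => [r2|r2|[_ j]].
  + apply: Or31; apply: coll_rel dis.
    by apply: (coll_exchange M1 nab (rel_coll r1) (rel_coll r2)).
  + by apply: Or33; split=> //; exact: mixed.
  + by apply: Or33; split=> //; apply: flip; exact: joined.
- case: (rd) => [r2|r2|[_ j]].
  + by apply: Or33; split=> //; apply: flip; exact: mixed.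
  + apply: Or32; apply: coll_rel dis.
    by apply: (coll_exchange M2 nab (rel_coll r1) (rel_coll r2)).
  + by apply: Or33; split=> //; apply: flip; exact: joined.
Qed.

Lemma amalgam_restrict1 P Q R1 R2 x y z : amalgam_data P Q R1 R2 ->
  P x -> P y -> P z -> amalgam (P `&` Q) R1 R2 x y z <-> R1 x y z.
Proof.
move=> D Px Py Pz; split; last exact: Or31.
have M2 := am_matroid2 D.
case=> [//|r|[dis [a [b [[Aa Ab nab] [jx jy jz]]]]]].
  have [r1 _ r2 _ _] := matroid_sym M2 r.
  apply/(am_agree D) => //; split=> //.
  - exact: (am_supp2 D r2).
  - exact: (am_supp2 D r1).
  - exact: (am_supp2 D r).
apply: coll_rel dis; apply: (coll_span (am_matroid1 D) nab);
  exact: (joined_line1 D).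
Qed.

(** A line spanned in [P] that leaves [P] is fused: a triple of [R1] would stay in [P], and a triple
    of [R2] forces its two points of [P] to be shared. Two such lines through [x] coincide by
    [joined_line_meet]. *)
Lemma amalgam_closed1 P Q R1 R2 : amalgam_data P Q R1 R2 ->
  meet_closed (amalgam (P `&` Q) R1 R2) P.
Proof.
move=> D a b c d x Pa Pb Pc Pd nab ncd cx cx' nPx.
have M2 := am_matroid2 D.
have key e f : P e -> P f -> e <> f -> coll (amalgam (P `&` Q) R1 R2) e f x ->
    on_joined_line (P `&` Q) R1 R2 e f x.
  move=> Pe Pf nef [//|ex|fx|[r|r|[]//]].
  - by case: nPx; rewrite -ex.
  - by case: nPx; rewrite -fx.
  - by case: nPx; exact: (am_supp1 D r).
  have [r1 _ r2 _ _] := matroid_sym M2 r.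
  exists e, f; split; split=> //; try by [left; exact: coll_l|left; exact: coll_r].
  - by split=> //; exact: (am_supp2 D r2).
  - by split=> //; exact: (am_supp2 D r1).
  - by right; exact: rel_coll.
have [u [v [[Au Av nuv] [ja jb jx]]]] := key _ _ Pa Pb nab cx.
have [u' [v' [[Au' Av' nuv'] [jc jd jx']]]] := key _ _ Pc Pd ncd cx'.
have nAx : ~ (P `&` Q) x by case.
have [ju jv] := joined_line_meet D Au Av Au' Av' nuv nuv' jx jx' nAx.
have trans y : joined_line R1 R2 u' v' y -> joined_line R1 R2 u v y.
  by exact: (joined_line_trans D Au Av Au' Av' nuv nuv' ju jv).
have line_coll y : P y -> joined_line R1 R2 u v y ->
    coll (amalgam (P `&` Q) R1 R2) a b y.
  move=> Py jy.
  have [->|nay] := EM (a = y); first exact: coll_l.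
  have [->|nby] := EM (b = y); first exact: coll_r.
  by apply: Or44; apply: Or33; split=> //; exists u, v.
by split; apply: line_coll => //; exact: trans.
Qed.

Lemma amalgam_swap P Q R1 R2 :
  amalgam (P `&` Q) R1 R2 = amalgam (Q `&` P) R2 R1.
Proof.
rewrite setIC; apply/funext=> x; apply/funext=> y; apply/funext=> z.
by apply/propext; split; exact: amalgamC.
Qed.

Lemma amalgam_restrict2 P Q R1 R2 x y z : amalgam_data P Q R1 R2 ->
  Q x -> Q y -> Q z -> amalgam (P `&` Q) R1 R2 x y z <-> R2 x y z.
Proof.
by rewrite amalgam_swap => D; apply: amalgam_restrict1; exact: amalgam_data_sym.
Qed.

Lemma amalgam_closed2 P Q R1 R2 : amalgam_data P Q R1 R2 ->
  meet_closed (amalgam (P `&` Q) R1 R2) Q.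
Proof.
by rewrite amalgam_swap => D; apply: amalgam_closed1; exact: amalgam_data_sym.
Qed.

Lemma amalgam_supp P Q R1 R2 x y z : amalgam_data P Q R1 R2 ->
  amalgam (P `&` Q) R1 R2 x y z -> (P `|` Q) z.
Proof.
move=> D [r|r|[_ [a [b [[Aa Ab nab] [_ _ jz]]]]]].
- by left; exact: (am_supp1 D r).
- by right; exact: (am_supp2 D r).
- exact: (joined_line_supp D Aa Ab nab jz).
Qed.

End Amalgam.

(** * Transport of relations and of meet-closedness *)

Lemma coll_mono (V : Type) (R R' : V -> V -> V -> Prop) x y z :
  (R x y z -> R' x y z) -> coll R x y z -> coll R' x y z.
Proof.
move=> h [?|?|?|/h ?]; [exact: Or41|exact: Or42|exact: Or43|exact: Or44].
Qed.

(** Vacuous: no point outside [A] lies on a line through two distinct points of [A]. *)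
Lemma meet_closed_supp (V : Type) (R : V -> V -> V -> Prop) (A : set V) :
  (forall x y z, R x y z -> A z) -> meet_closed R A.
Proof.
move=> supp a b c d x Aa Ab Ac Ad nab ncd [//|ax|bx|/supp//] _ nAx.
  by case: nAx; rewrite -ax.
by case: nAx; rewrite -bx.
Qed.

Definition image_rel (T U : Type) (h : T -> U) (P : set T)
    (R : T -> T -> T -> Prop) (u v w : U) : Prop :=
  exists x y z, [/\ P x, P y & P z] /\ [/\ h x = u, h y = v, h z = w & R x y z].

Section ImageRelation.
Variables (T U : Type) (h : T -> U) (P : set T) (R : T -> T -> T -> Prop).
Hypothesis h_inj : forall x y, P x -> P y -> h x = h y -> x = y.

Lemma image_relE x y z : P x -> P y -> P z ->
  image_rel h P R (h x) (h y) (h z) <-> R x y z.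
Proof.
move=> Px Py Pz; split=> [[x' [y' [z' [[Px' Py' Pz'] [ex ey ez r]]]]]|r].
  by rewrite -(h_inj Px' Px ex) -(h_inj Py' Py ey) -(h_inj Pz' Pz ez).
by exists x, y, z.
Qed.

Lemma image_rel_coll x y z : P x -> P y -> P z ->
  coll (image_rel h P R) (h x) (h y) (h z) <-> coll R x y z.
Proof.
move=> Px Py Pz; split.
  case=> [/h_inj e|/h_inj e|/h_inj e|/image_relE e].
  - by apply: Or41; exact: e.
  - by apply: Or42; exact: e.
  - by apply: Or43; exact: e.
  - by apply: Or44; exact: e.
case=> [->|->|->|r]; [exact: Or41|exact: Or42|exact: Or43|].
by apply: Or44; exact/image_relE.
Qed.

Lemma image_rel_supp u v w : image_rel h P R u v w -> (h @` P) w.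
Proof. by move=> [x [y [z [[? ? ?] [? ? <- ?]]]]]; exists z. Qed.

Hypothesis MR : simple_matroid R.

Lemma image_rel_matroid : simple_matroid (image_rel h P R).
Proof.
apply: simple_matroid_intro.
- move=> _ _ _ [x [y [z [[Px Py Pz] [<- <- <- r]]]]].
  by have [n1 n2 n3] := matroid_irr MR r; split=> /h_inj e; auto.
- move=> _ _ _ [x [y [z [[Px Py Pz] [<- <- <- r]]]]].
  by have [? ? ? ? ?] := matroid_sym MR r; apply/image_relE.
- move=> _ _ _ [x [y [z [[Px Py Pz] [<- <- <- r]]]]].
  by have [? ? ? ? ?] := matroid_sym MR r; apply/image_relE.
move=> _ _ _ d [x [y [z [[Px Py Pz] [<- <- <- r]]]]].
move=> [x' [y' [t [[Px' Py' Pt] [ex ey <- r']]]]] nzt.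
move: r'; rewrite (h_inj Px' Px ex) (h_inj Py' Py ey) => r'.
apply/image_relE => //.
have [nxy nxz _] := matroid_irr MR r; have [_ nxt _] := matroid_irr MR r'.
apply: coll_rel; last by split=> // e; apply: nzt; rewrite e.
exact: (coll_exchange MR nxy (rel_coll r) (rel_coll r')).
Qed.

Lemma image_rel_closed (A : set T) :
  A `<=` P -> meet_closed R A -> meet_closed (image_rel h P R) (h @` A).
Proof.
move=> AP cl _ _ _ _ x [a Aa <-] [b Ab <-] [c Ac <-] [d Ad <-] nab ncd cx cx' nAx.
have [x' Px' ex] : exists2 x', P x' & h x' = x.
  case: cx => [//|<-|<-|/image_rel_supp[x' Px' <-]].
  - by exists a => //; exact: AP.
  - by exists b => //; exact: AP.
  - by exists x'.
move: cx cx'; rewrite -ex.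
have Pa := AP _ Aa; have Pb := AP _ Ab; have Pc := AP _ Ac; have Pd := AP _ Ad.
move=> /image_rel_coll cx /image_rel_coll cx'.
have [] := cl a b c d x' Aa Ab Ac Ad _ _ (cx Pa Pb Px') (cx' Pc Pd Px') _.
- by move=> e; apply: nab; rewrite e.
- by move=> e; apply: ncd; rewrite e.
- by move=> Ax; apply: nAx; exists x'.
by move=> ? ?; split; apply/image_rel_coll.
Qed.

End ImageRelation.

(** * Finite extension problems and their one-step solution *)

(* [r] is a finite structure on [0, m); its initial segment of length [size s]
   is identified with the finite substructure of [R] listed by [s]. *)
Record extension_problem (R : nat -> nat -> nat -> Prop) (s : seq nat) (m : nat)
    (r : nat -> nat -> nat -> Prop) : Prop := {
  ep_uniq : uniq s;
  ep_size : size s <= m;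
  ep_matroid : simple_matroid r;
  ep_supp : forall i j l, r i j l -> l < m;
  ep_closed : meet_closed r `I_(size s);
  ep_closed_image : meet_closed R [set` s];
  ep_rel : forall i j l, i < size s -> j < size s -> l < size s ->
    (r i j l <-> R (nth 0 s i) (nth 0 s j) (nth 0 s l))
}.

Record extension_solution (R : nat -> nat -> nat -> Prop) (s : seq nat) (m : nat)
    (r : nat -> nat -> nat -> Prop) (g : nat -> nat) : Prop := {
  es_inj : forall i j, i < m -> j < m -> g i = g j -> i = j;
  es_extends : forall i, i < size s -> g i = nth 0 s i;
  es_closed : meet_closed R (g @` `I_m);
  es_rel : forall i j l, i < m -> j < m -> l < m ->
    (r i j l <-> R (g i) (g j) (g l))
}.

Definition stage := (nat * (nat -> nat -> nat -> Prop))%type.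

Definition stage_valid (S : stage) : Prop :=
  simple_matroid S.2 /\ forall x y z, S.2 x y z -> z < S.1.

Record stage_extends (S S' : stage) : Prop := {
  se_lt : S.1 < S'.1;
  se_rel : forall x y z, x < S.1 -> y < S.1 -> z < S.1 ->
    (S'.2 x y z <-> S.2 x y z);
  se_closed : meet_closed S'.2 `I_(S.1)
}.

(** Conditional, so that a task that poses no extension problem over [S] counts as solved by any
    stage. *)
Definition stage_solves (S S' : stage) s m r : Prop :=
  extension_problem S.2 s m r -> (forall x, x \in s -> x < S.1) ->
  exists g, extension_solution S'.2 s m r g /\ forall i, i < m -> g i < S'.1.

Lemma stage_grow (S : stage) : stage_valid S ->
  stage_valid (S.1.+1, S.2) /\ stage_extends S (S.1.+1, S.2).
Proof.
move=> [MS supp]; split; split=> //=.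
  by move=> x y z /supp/ltnW.
exact: meet_closed_supp.
Qed.

Lemma stage_step (S : stage) s m r : stage_valid S ->
  exists S', [/\ stage_valid S', stage_extends S S' & stage_solves S S' s m r].
Proof.
move=> vS.
(* If the task poses no problem over [S], the bound still grows by one, which keeps the bounds
   unbounded along the chain. *)
have [[E lts]|nE] :=
    EM (extension_problem S.2 s m r /\ forall x, x \in s -> x < S.1); last first.
  have [v e] := stage_grow vS; exists (S.1.+1, S.2); split=> // E lts.
  by case: nE.
case: S vS E lts => k R [/= MR supp] E lts.
(* Identified points go to their namesakes in [s]; every other point goes to a fresh number at or
   above [k]. *)
pose g i := if i < size s then nth 0 s i else k + i.
have gs i : i < size s -> g i = nth 0 s i by rewrite /g => ->.
have gk i : i < size s -> g i < k by move=> h; rewrite gs// lts// mem_nth.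
have gk' i : size s <= i -> g i = k + i by rewrite /g ltnNge => ->.
have g_lt i : g i < k -> i < size s.
  by rewrite /g; case: (ltnP i (size s)) => // _; rewrite ltnNge leq_addr.
have g_inj i j : i < m -> j < m -> g i = g j -> i = j.
  move=> _ _ gij; case: (ltnP i (size s)) => hi; case: (ltnP j (size s)) => hj.
  - by move: gij; rewrite !gs// => /eqP; rewrite nth_uniq// ?(ep_uniq E)// => /eqP.
  - by have := gk _ hi; rewrite gij => /g_lt; rewrite ltnNge hj.
  - by have := gk _ hj; rewrite -gij => /g_lt; rewrite ltnNge hi.
  - by move: gij; rewrite !gk'// => /addnI.
pose Q := g @` `I_m.
(* The placed copy meets the old segment exactly in the points of [s], which become the shared part
   of the amalgam. *)
have PQ : `I_k `&` Q = g @` `I_(size s).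
  apply/seteqP; split=> [x [/= lt [i im gx]]|_ [i /= hi <-]].
    by exists i => //=; apply: g_lt; rewrite gx.
  by split; [exact: gk|exists i => //=; exact: leq_trans (ep_size E)].
have PQs : `I_k `&` Q = [set` s].
  rewrite PQ; apply/seteqP; split=> [_ [i /= hi <-]|x /= xs].
    by rewrite gs// mem_nth.
  have hi : index x s < size s by rewrite index_mem.
  by exists (index x s) => //; rewrite gs// nth_index.
have D : amalgam_data `I_k Q R (image_rel g `I_m r).
  split=> //.
  - by apply: image_rel_matroid => //; exact: (ep_matroid E).
  - by move=> x y z r2; exact: (image_rel_supp r2).
  - rewrite PQ => _ _ _ [i /= hi <-] [j /= hj <-] [l /= hl <-].
    have ltm i' : i' < size s -> i' < m by move=> h; exact: leq_trans (ep_size E).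
    rewrite image_relE //=; try exact: ltm.
    by rewrite (ep_rel E)// !gs//; split.
  - by rewrite PQs; exact: (ep_closed_image E).
  - rewrite PQ; apply: image_rel_closed => //; last exact: (ep_closed E).
    by move=> i /= hi; exact: leq_trans (ep_size E).
(* The bound [k + m.+1] exceeds every new point and is larger than [k] even when [m] is zero. *)
exists (k + m.+1, amalgam (`I_k `&` Q) R (image_rel g `I_m r)); split.
- split; first exact: (amalgam_matroid D).
  move=> x y z /(amalgam_supp D) [/= lt|[i /= im <-]].
    by exact: (leq_trans lt (leq_addr _ _)).
  rewrite /g; case: (ltnP i (size s)) => hi; last by rewrite ltn_add2l ltnS ltnW.
  by apply: (@leq_trans k); [exact/lts/mem_nth|exact: leq_addr].
- split=> /=; first by rewrite -addSnnS leq_addr.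
    by move=> x y z *; exact: (amalgam_restrict1 D).
  exact: (amalgam_closed1 D).
move=> _ _; exists g; split; last first.
  move=> i im /=; case: (ltnP i (size s)) => hi; last first.
    by rewrite gk'// ltn_add2l ltnS ltnW.
  by apply: (@leq_trans k); [exact: gk|exact: leq_addr].
split=> //=; first exact: (amalgam_closed2 D).
move=> i j l im jm lm.
rewrite (amalgam_restrict2 D); [|by exists i|by exists j|by exists l].
by rewrite image_relE.
Qed.

(** * Scheduling of tasks and the limit relation *)

(** Finite relations are coded by lists, so that tasks form a countable type and can be
    enumerated. *)
Definition triples_rel (t : seq (nat * nat * nat)) (i j l : nat) : Prop :=
  (i, j, l) \in t.

Lemma triples_relP (m : nat) (r : nat -> nat -> nat -> Prop) :
  simple_matroid r -> (forall i j l, r i j l -> l < m) ->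
  exists t, triples_rel t = r.
Proof.
move=> Mr supp.
pose I := iota 0 m.
exists [seq x <- [seq (y, l) | y <- [seq (i, j) | i <- I, j <- I], l <- I]
          | `[< r x.1.1 x.1.2 x.2 >]].
apply/funext=> i; apply/funext=> j; apply/funext=> l; apply/propext.
rewrite /triples_rel mem_filter /=; split=> [/andP[/asboolP]//|h].
apply/andP; split; first exact/asboolP.
have [h1 _ h2 _ _] := matroid_sym Mr h.
by rewrite !allpairs_f// mem_iota add0n; [exact: supp h2|exact: supp h1|exact: supp h].
Qed.

(** If the common point lies in [B], the relations agree there and closedness of [A] for [R]
    applies; otherwise closedness of [B] for [R'] does. *)
Lemma meet_closed_trans (R R' : nat -> nat -> nat -> Prop) (A B : set nat) :
  A `<=` B ->
  (forall x y z, B x -> B y -> B z -> (R' x y z <-> R x y z)) ->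
  meet_closed R A -> meet_closed R' B -> meet_closed R' A.
Proof.
move=> AB e clA clB a b c d x Aa Ab Ac Ad nab ncd cx cx' nAx.
have Ba := AB _ Aa; have Bb := AB _ Ab; have Bc := AB _ Ac; have Bd := AB _ Ad.
have [Bx|nBx] := EM (B x); last exact: (clB a b c d x).
have [] := clA a b c d x Aa Ab Ac Ad nab ncd _ _ nAx.
- by apply: coll_mono cx => /e; apply.
- by apply: coll_mono cx' => /e; apply.
by move=> c1 c2; split; [apply: coll_mono c1|apply: coll_mono c2] => /e; apply.
Qed.

Definition task := (seq nat * nat * seq (nat * nat * nat))%type.

Theorem exists_generic_relation : exists R : nat -> nat -> nat -> Prop,
  [/\ simple_matroid R,
      forall n, exists2 k, n <= k & meet_closed R `I_k &
      forall s m r, extension_problem R s m r ->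
        exists g, extension_solution R s m r g].
Proof.
pose next (v : {S | stage_valid S}) (t : task) (v' : {S | stage_valid S}) :=
  stage_extends (sval v) (sval v') /\
  stage_solves (sval v) (sval v') t.1.1 t.1.2 (triples_rel t.2).
have /choice[f fP] : forall vt, exists v', next vt.1 vt.2 v'.
  move=> [[S vS] t].
  have [S' [vS' eS' sS']] := @stage_step S t.1.1 t.1.2 (triples_rel t.2) vS.
  by exists (exist _ S' vS').
have v0 : stage_valid (0, fun _ _ _ => False) by split=> //; exact: simple_matroid_intro.
(* every task is scheduled at arbitrarily late stages *)
pose tasks n : task :=
  if (unpickle n : option (nat * task)) is Some x then x.2 else ([::], 0, [::]).
pose chain := fix chain n : {S | stage_valid S} :=
  if n is n'.+1 then f (chain n', tasks n') else exist _ _ v0.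
pose k n := (sval (chain n)).1; pose R n := (sval (chain n)).2.
have MR n : simple_matroid (R n) by have [] := svalP (chain n).
have suppR n x y z : R n x y z -> [/\ x < k n, y < k n & z < k n].
  have [_ supp] := svalP (chain n); move=> r.
  by have [h1 _ h2 _ _] := matroid_sym (MR n) r; split;
    [exact: supp h2|exact: supp h1|exact: supp r].
have ext n : stage_extends (sval (chain n)) (sval (chain n.+1)).
  by have [] := fP (chain n, tasks n).
have le_k n n' : n <= n' -> k n <= k n'.
  elim: n' => [|n' IH]; first by rewrite leqn0 => /eqP->.
  rewrite leq_eqVlt => /orP[/eqP->//|/IH h].
  by apply: leq_trans h _; exact: ltnW (se_lt (ext n')).
have n_le_k n : n <= k n.
  by elim: n => // n IH; exact: (leq_ltn_trans IH (se_lt (ext n))).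
have resR n n' x y z : n <= n' -> x < k n -> y < k n -> z < k n ->
    (R n' x y z <-> R n x y z).
  elim: n' => [|n' IH]; first by rewrite leqn0 => /eqP->.
  rewrite leq_eqVlt => /orP[/eqP->//|nn' hx hy hz].
  rewrite -IH//; have le := le_k n n' nn'.
  by apply: (se_rel (ext n')); [exact: (leq_trans hx le)|
     exact: (leq_trans hy le)|exact: (leq_trans hz le)].
have closR n n' : n <= n' -> meet_closed (R n') `I_(k n).
  elim: n' => [|n' IH].
    rewrite leqn0 => /eqP->.
    by apply: meet_closed_supp => x y z /suppR[].
  rewrite leq_eqVlt => /orP[/eqP->|nn'].
    by apply: meet_closed_supp => x y z /suppR[].
  have le := le_k n n' nn'.
  apply: meet_closed_trans (IH nn') (se_closed (ext n')).
    by move=> x /= hx; exact: (leq_trans hx le).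
  by move=> x y z *; apply: (se_rel (ext n')).
pose L x y z := exists n, R n x y z.
have resL n x y z : x < k n -> y < k n -> z < k n -> (L x y z <-> R n x y z).
  move=> hx hy hz; split=> [[n' r]|r]; last by exists n.
  have [h1 h2 h3] := suppR _ _ _ _ r.
  apply/(resR n (maxn n n')) => //; first exact: leq_maxl.
  by apply/(resR n' (maxn n n')) => //; exact: leq_maxr.
have collL n x y z : x < k n -> y < k n -> z < k n ->
    (coll L x y z <-> coll (R n) x y z).
  by move=> hx hy hz; split; apply: coll_mono => /(resL n); apply.
have closL n (A : set nat) : A `<=` `I_(k n) -> meet_closed (R n) A ->
    meet_closed L A.
  move=> AI cl a b c d x Aa Ab Ac Ad nab ncd cx cx' nAx.
  (* The point [x] may lie beyond stage [n], so closedness of [A] is first carried to a stage whose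
     bound exceeds [x]. *)
  pose n' := maxn n x.+1.
  have nn' : n <= n' by exact: leq_maxl.
  have xn' : x < k n' by apply: leq_trans (n_le_k _); exact: leq_maxr.
  have lt y : A y -> y < k n'.
    by move=> /AI h; apply: leq_trans (le_k n n' nn').
  have clA : meet_closed (R n') A.
    apply: meet_closed_trans AI _ cl (closR _ _ nn').
    by move=> u v w *; exact: resR.
  have [] := clA a b c d x Aa Ab Ac Ad nab ncd _ _ nAx.
  - by apply/collL => //; exact: lt.
  - by apply/collL => //; exact: lt.
  by move=> *; split; apply/(collL n') => //; exact: lt.
exists L; split.
- have lift (x y z t : nat) : exists n, [/\ x < k n, y < k n, z < k n & t < k n].
    exists (maxn (maxn x y) (maxn z t)).+1.
    by split; apply: leq_trans (n_le_k _); rewrite ltnS !leq_max leqnn ?orbT.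
  apply: simple_matroid_intro.
  + by move=> a b c [n /(matroid_irr (MR n))].
  + by move=> a b c [n /(matroid_sym (MR n))[*]]; exists n.
  + by move=> a b c [n /(matroid_sym (MR n))[*]]; exists n.
  move=> a b c d rc rd ncd; have [n [ha hb hc hd]] := lift a b c d.
  move: rc rd => /(resL n) rc /(resL n) rd; apply/(resL n) => //.
  have {}rc := rc ha hb hc; have {}rd := rd ha hb hd.
  have [nab nac _] := matroid_irr (MR n) rc.
  have [_ nad _] := matroid_irr (MR n) rd.
  apply: coll_rel => //.
  exact: (coll_exchange (MR n) nab (rel_coll rc) (rel_coll rd)).
- move=> n; exists (k n); first exact: n_le_k.
  by apply: closL (closR n n _).
move=> s m r E.
have [t et] := triples_relP (ep_matroid E) (@ep_supp _ _ _ _ E).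
(* The task must be treated at a stage whose segment already contains all of [s]. *)
pose N := \max_(x <- s) x.+1.
have [n [sn En]] : exists n, N <= n /\ tasks n = (s, m, t).
  have [j] : exists j : nat, N <= pickle (j, (s, m, t) : task).
    (* Pigeonhole: the codes for [N.+1] distinct values of [j] are distinct, so they cannot all lie
       below [N]. *)
    apply: contrapT => /forallNP H.
    have inj : injective (fun j : 'I_N.+1 => pickle (val j, (s, m, t) : task)).
      by move=> i j /= /(pcan_inj pickleK) [] /val_inj.
    have lt (j : 'I_N.+1) : pickle (val j, (s, m, t) : task) < N.
      by rewrite ltnNge; apply/negP; exact: H.
    have := @leq_card _ _ (fun j => Ordinal (lt j)).
    rewrite !card_ord ltnn => /(_ _)/negP; apply; last by [].
    by move=> i j [] /inj.
  by move=> h; exists (pickle (j, (s, m, t) : task)); rewrite /tasks pickleK.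
have lts x : x \in s -> x < k n.
  move=> xs; apply: leq_trans (n_le_k _); apply: leq_trans sn.
  by rewrite /N (big_rem x)//= leq_maxl.
(* The problem over [L] is restated over stage [n], solved at stage [n.+1], and the solution is read
   back in [L]. *)
have [_] := fP (chain n, tasks n); rewrite /stage_solves /= En /= et.
case=> //.
  split; [exact: (ep_uniq E)|exact: (ep_size E)|exact: (ep_matroid E)|
    exact: (@ep_supp _ _ _ _ E)|exact: (ep_closed E)| |].
    move=> a b c d x Aa Ab Ac Ad nab ncd cx cx' nAx.
    have [] := ep_closed_image E Aa Ab Ac Ad nab ncd _ _ nAx.
    - by apply: coll_mono cx => r1; exists n.
    - by apply: coll_mono cx' => r1; exists n.
    by move=> ? ?; split; apply/collL => //; exact: lts.
  move=> i j l hi hj hl; rewrite (ep_rel E)//.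
  by apply: resL; apply: lts; exact: mem_nth.
move=> g [[ginj gext gcl grel] glt]; exists g.
have {}glt i : i < m -> g i < k n.+1.
  by move=> im; have := glt i im; rewrite /k /= En.
have eR : (sval (f (chain n, (s, m, t)))).2 = R n.+1 by rewrite /R /= En.
rewrite eR in gcl grel.
split=> //.
  by apply: (closL n.+1) => // _ [i /= im <-]; exact: glt.
by move=> i j l im jm lm; rewrite grel//; apply: iff_sym; apply: resL; exact: glt.
Qed.

(** * Meets of lines and the wedge operation *)

Lemma in_lineE (V : Type) (R : V -> V -> V -> Prop) a b x :
  a <> b -> line R a b x <-> coll R a b x.
Proof.
move=> nab; split=> [[[->|->]|r]|[//|->|->|r]].
- exact: coll_l.
- exact: coll_r.
- exact: rel_coll.
- by left; left.
- by left; right.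
- by right.
Qed.

(** Distinct lines share at most one point, so the equation with a singleton reduces to membership
    of [p]; the lines are equal exactly when the first contains [c] and [d]. *)
Lemma lines_meet_atP (V : Type) (R : V -> V -> V -> Prop) a b c d p :
  simple_matroid R ->
  lines_meet_at R a b c d p <->
  [/\ a <> b, c <> d, ~ (coll R a b c /\ coll R a b d),
      coll R a b p /\ coll R c d p & ~ [set a; b; c; d] p].
Proof.
move=> MR; split=> [[nab ncd nl meet nin]|[nab ncd nl [c1 c2] nin]].
  have [l1 l2] : (line R a b `&` line R c d) p by rewrite meet.
  split=> //; last by split; apply/in_lineE.
  move=> [cc cd]; apply: nl; apply/seteqP.
  split=> x /in_lineE h; apply/in_lineE => //.
    by apply: (coll_span MR nab) => //; exact: h.
  by apply: (coll_span_sym MR nab ncd cc cd); exact: h.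
split=> //.
- move=> e; apply: nl; split; apply/in_lineE; rewrite // e; apply/in_lineE => //.
    exact: coll_l.
  exact: coll_r.
apply/seteqP; split=> [x [/in_lineE h1 /in_lineE h2]|_ ->] /=; last first.
  by split; apply/in_lineE.
apply: contrapT => nxp; apply: nl.
have {}h1 := h1 nab; have {}h2 := h2 ncd.
split; apply: (coll_span_sym MR nab nxp h1 c1); apply: (coll_span MR ncd h2 c2).
  exact: coll_l.
exact: coll_r.
Qed.

Lemma exists_wedge (V : Type) (R : V -> V -> V -> Prop) :
  exists w, wedge_spec R w.
Proof.
have /choice[w wP] : forall q : V * V * V * V, exists x,
    let: (a, b, c, d) := q in (forall p, lines_meet_at R a b c d p -> x = p) /\
    (~ (exists p, lines_meet_at R a b c d p) -> x = a).
  move=> [[[a b] c] d].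
  have [[p hp]|nh] := EM (exists p, lines_meet_at R a b c d p).
    exists p; split=> [p' hp'|[]]; last by exists p.
    have [_ _ _ m1 _] := hp; have [_ _ _ m2 _] := hp'.
    have : [set p] p by [].
    by rewrite -m1 m2.
  by exists a; split=> // p hp; case: nh; exists p.
exists (fun a b c d => w (a, b, c, d)).
split=> a b c d; first by move=> p; case: (wP (a, b, c, d)) => h _; exact: h.
by case: (wP (a, b, c, d)).
Qed.

(** A common point outside [A] differs from all four arguments, so the wedge returns it when the
    lines are distinct. Conversely a wedge value is either a meet or the default [a], which is in
    [A]. *)
Lemma substructureP (M : wmatroid) (A : set M) :
  substructure A <-> meet_closed (@mrel M) A.
Proof.
have MR := mrelP M; split=> [sub|cl].
  move=> a b c d x Aa Ab Ac Ad nab ncd cx cx' nAx.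
  apply: contrapT => nl; apply: (nAx).
  have /(wedge_meet (mwedgeP M)) <- : lines_meet_at (@mrel M) a b c d x.
    apply/lines_meet_atP => //; split=> // -[[[]|]|] /= e; by rewrite e in nAx.
  exact: sub.
move=> a b c d Aa Ab Ac Ad.
have [[p hp]|nh] := EM (exists p, lines_meet_at (@mrel M) a b c d p); last first.
  by rewrite (wedge_default (mwedgeP M) nh).
rewrite (wedge_meet (mwedgeP M) hp); apply: contrapT => nAp.
move: hp => /lines_meet_atP[//|nab ncd nl [c1 c2] _].
by apply: nl; exact: (cl a b c d p).
Qed.

Lemma finitely_generated_closed (M : wmatroid) (A : set M) :
  finitely_generated A -> meet_closed (@mrel M) A.
Proof.
move=> [S [_ ->]]; apply/substructureP => a b c d Aa Ab Ac Ad X subX.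
by case: (subX) => closedX _; apply: closedX; [exact: (Aa X)|exact: (Ab X)|
  exact: (Ac X)|exact: (Ad X)].
Qed.

Lemma meet_closedT (V : Type) (R : V -> V -> V -> Prop) : meet_closed R setT.
Proof. by move=> a b c d x _ _ _ _ _ _ _ _ []. Qed.

(** Meets transfer both ways: a meet over [A] stays in [A], and a meet over the image stays in the
    image, hence comes from [A]. Without a meet both sides take the default value, the first
    argument. *)
Lemma preserves_on_of_rel (M N : wmatroid) (A : set M) (f : M -> N) :
  (forall x y, A x -> A y -> f x = f y -> x = y) ->
  meet_closed (@mrel M) A -> meet_closed (@mrel N) (f @` A) ->
  (forall a b c, A a -> A b -> A c -> (mrel a b c <-> mrel (f a) (f b) (f c))) ->
  preserves_on A f.
Proof.
move=> f_inj clA /substructureP clB rel; split=> // a b c d Aa Ab Ac Ad.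
have MR := mrelP M; have NR := mrelP N.
have collE x y z : A x -> A y -> A z ->
    coll (@mrel M) x y z <-> coll (@mrel N) (f x) (f y) (f z).
  move=> Ax Ay Az; split.
    case=> [->|->|->|/rel h]; [exact: Or41|exact: Or42|exact: Or43|].
    by apply: Or44; exact: h.
  case=> [/f_inj h|/f_inj h|/f_inj h|/rel h].
  - by apply: Or41; exact: h.
  - by apply: Or42; exact: h.
  - by apply: Or43; exact: h.
  - by apply: Or44; exact: h.
have meetE p : A p -> lines_meet_at (@mrel M) a b c d p <->
    lines_meet_at (@mrel N) (f a) (f b) (f c) (f d) (f p).
  move=> Ap; rewrite !lines_meet_atP//.
  have neq x y : A x -> A y -> (x <> y) <-> (f x <> f y).
    move=> Ax Ay; split=> h e; first by apply: h; exact: f_inj.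
    by apply: h; rewrite e.
  have inE : [set a; b; c; d] p <-> [set f a; f b; f c; f d] (f p).
    split; first by move=> [[[]|]|] /= ->; rewrite /setU /=; tauto.
    by move=> [[[]|]|] /= /f_inj ->//; rewrite /setU /=; tauto.
  by rewrite (propext (neq a b Aa Ab)) (propext (neq c d Ac Ad))
    (propext (collE a b c Aa Ab Ac)) (propext (collE a b d Aa Ab Ad))
    (propext (collE a b p Aa Ab Ap)) (propext (collE c d p Ac Ad Ap))
    (propext inE).
have [[p hp]|nh] := EM (exists p, lines_meet_at (@mrel M) a b c d p).
  have Ap : A p.
    rewrite -(wedge_meet (mwedgeP M) hp).
    by move/substructureP: clA => subA; exact: subA.
  rewrite (wedge_meet (mwedgeP M) hp); apply/esym.
  by apply: (wedge_meet (mwedgeP N)); exact/meetE.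
rewrite (wedge_default (mwedgeP M) nh); apply/esym.
apply: (wedge_default (mwedgeP N)) => -[q hq]; apply: nh.
have [p Ap ep] : (f @` A) q.
  by rewrite -(wedge_meet (mwedgeP N) hq); apply: clB; exact: imageP.
by exists p; apply/meetE => //; rewrite ep.
Qed.

(** * Back and forth between finite meet-closed sets *)

(** A finite map stored as its graph; the two uniqueness conditions say that it is functional and
    injective. *)
Record partial_iso (R : nat -> nat -> nat -> Prop) (p : seq (nat * nat)) : Prop := {
  pi_uniq1 : uniq (unzip1 p);
  pi_uniq2 : uniq (unzip2 p);
  pi_closed1 : meet_closed R [set` unzip1 p];
  pi_closed2 : meet_closed R [set` unzip2 p];
  pi_rel : forall u v w, u \in p -> v \in p -> w \in p ->
    (R u.1 v.1 w.1 <-> R u.2 v.2 w.2)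
}.

Section BackAndForth.
Variable R : nat -> nat -> nat -> Prop.
Hypothesis MR : simple_matroid R.
Hypothesis R_exhaust : forall n, exists2 k, n <= k & meet_closed R `I_k.
Hypothesis R_extend : forall s m r, extension_problem R s m r ->
  exists g, extension_solution R s m r g.

(** The domain is enlarged at once to a meet-closed initial segment containing [x]. Seen through
    [p], that segment is an extension problem over the range of [p], and its solution supplies the
    new values. *)
Lemma partial_iso_forth p x : partial_iso R p ->
  exists q, [/\ partial_iso R q, {subset p <= q} & x \in unzip1 q].
Proof.
move=> pi.
have [k lek clk] := R_exhaust (\max_(y <- x :: unzip1 p) y.+1).
have ltk y : y \in x :: unzip1 p -> y < k.
  by move=> yin; apply: leq_trans lek; rewrite (big_rem y)//= leq_maxl.
(* The domain of [p] is listed first, so that its points receive the initial indices in the order of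
   [p]. *)
pose e := unzip1 p ++ [seq i <- iota 0 k | i \notin unzip1 p].
have eP y : (y \in e) = (y < k).
  rewrite mem_cat mem_filter mem_iota add0n /=.
  case: (boolP (y \in unzip1 p)) => //= yp.
  by rewrite ltk// inE yp orbT.
have ue : uniq e.
  rewrite cat_uniq (pi_uniq1 pi) filter_uniq ?iota_uniq// andbT /=.
  by apply/hasPn => y; rewrite mem_filter => /andP[].
have sp : size (unzip1 p) = size (unzip2 p) by rewrite !size_map.
have size_e : size (unzip1 p) <= size e by rewrite size_cat leq_addr.
have index_inj y z : [set` e] y -> [set` e] z -> index y e = index z e -> y = z.
  by move=> /= ye ze /(congr1 (nth 0 e)); rewrite !nth_index.
have index_p i : i < size (unzip1 p) -> index (nth 0 (unzip1 p) i) e = i.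
  by move=> h; rewrite index_cat mem_nth// index_uniq// (pi_uniq1 pi).
have p_in_e : [set` unzip1 p] `<=` [set` e].
  by move=> y /= yp; rewrite /e mem_cat yp.
pose r := image_rel (index^~ e) [set` e] R.
have rE a b c : a \in e -> b \in e -> c \in e ->
    r (index a e) (index b e) (index c e) <-> R a b c.
  by move=> ae be ce; exact: (image_relE R index_inj ae be ce).
have [|g [ginj gext gcl grel]] := @R_extend (unzip2 p) (size e) r.
  split.
  - exact: (pi_uniq2 pi).
  - by rewrite -sp.
  - exact: image_rel_matroid.
  - move=> i j l rl; have [y /= ye <-] := image_rel_supp rl.
    by rewrite index_mem.
  - have -> : `I_(size (unzip2 p)) = (index^~ e) @` [set` unzip1 p].
      rewrite -sp; apply/seteqP; split=> [i /= hi|_ [y /= yp <-]].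
        by exists (nth 0 (unzip1 p) i); [exact: mem_nth|exact: index_p].
      by rewrite index_cat yp index_mem.
    by apply: image_rel_closed => //; exact: (pi_closed1 pi).
  - exact: (pi_closed2 pi).
  move=> i j l; rewrite -sp => hi hj hl.
  rewrite -{1}(index_p i hi) -{1}(index_p j hj) -{1}(index_p l hl).
  rewrite rE; try by apply: p_in_e; exact: mem_nth.
  rewrite size_map in hi hj hl.
  rewrite !(nth_map (0, 0))//.
  by apply: (pi_rel pi); exact: mem_nth.
pose q := [seq (y, g (index y e)) | y <- e].
have q1 : unzip1 q = e by rewrite /unzip1 -map_comp map_id_in.
have q2 : unzip2 q = [seq g (index y e) | y <- e] by rewrite /unzip2 -map_comp.
exists q; split.
- split.
  + by rewrite q1.
  + rewrite q2 map_inj_in_uniq// => y z ye ze /ginj h.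
    by apply: index_inj => //; apply: h; rewrite index_mem.
  + rewrite q1; have -> : [set` e] = `I_k by apply/seteqP; split=> y /=; rewrite eP.
    by [].
  + rewrite q2.
    have -> : [set` [seq g (index y e) | y <- e]] = g @` `I_(size e); last by [].
    apply/seteqP; split=> [_ /= /mapP[y ye ->]|_ [i /= hi <-]].
      by exists (index y e); rewrite //= index_mem.
    by apply/mapP; exists (nth 0 e i); rewrite ?mem_nth ?index_uniq.
  move=> _ _ _ /mapP[u ue' ->] /mapP[v ve ->] /mapP[w we ->] /=.
  by rewrite -grel ?index_mem// rE.
- move=> [a b] abp; apply/mapP; exists a.
    by apply: p_in_e; exact: (map_f fst abp).
  have hi : index (a, b) p < size p by rewrite index_mem.
  have ea : nth 0 (unzip1 p) (index (a, b) p) = a.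
    by rewrite (nth_map (0, 0))// nth_index.
  have eb : nth 0 (unzip2 p) (index (a, b) p) = b.
    by rewrite (nth_map (0, 0))// nth_index.
  have ia : index a e = index (a, b) p by rewrite -{1}ea index_p ?size_map.
  by rewrite ia gext ?size_map// eb.
by rewrite q1 eP ltk// inE eqxx.
Qed.

Definition swap_pairs (p : seq (nat * nat)) := [seq (u.2, u.1) | u <- p].

Lemma partial_iso_swap p : partial_iso R p -> partial_iso R (swap_pairs p).
Proof.
have e1 : unzip1 (swap_pairs p) = unzip2 p by rewrite /unzip1 -map_comp.
have e2 : unzip2 (swap_pairs p) = unzip1 p by rewrite /unzip2 -map_comp.
move=> pi; split; rewrite ?e1 ?e2; try by case: pi.
move=> _ _ _ /mapP[u up ->] /mapP[v vp ->] /mapP[w wp ->] /=.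
by apply: iff_sym; exact: (pi_rel pi).
Qed.

Lemma partial_iso_back_forth p x : partial_iso R p ->
  exists q, [/\ partial_iso R q, {subset p <= q}, x \in unzip1 q & x \in unzip2 q].
Proof.
move=> /partial_iso_forth - /(_ x)[q [qi pq xq]].
have [q' [/partial_iso_swap q'i qq' xq']] := partial_iso_forth x (partial_iso_swap qi).
have qs : {subset q <= swap_pairs q'}.
  move=> [a b] uq; have /qq' h := map_f (fun u => (u.2, u.1)) uq.
  exact: (map_f (fun u => (u.2, u.1)) h).
exists (swap_pairs q'); split=> //.
- by move=> u /pq/qs.
- by move: xq => /mapP[u /qs us ->]; exact: map_f.
by rewrite /unzip2 -map_comp.
Qed.

Lemma partial_iso_extends p : partial_iso R p -> exists g : nat -> nat,
  [/\ injective g, forall y, exists x, g x = y,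
      forall a b c, R a b c <-> R (g a) (g b) (g c) &
      forall u, u \in p -> g u.1 = u.2].
Proof.
move=> pi.
have /choice[f fP] : forall vx : {q | partial_iso R q} * nat,
    exists q : {q | partial_iso R q}, [/\ {subset sval vx.1 <= sval q},
      vx.2 \in unzip1 (sval q) & vx.2 \in unzip2 (sval q)].
  move=> [[q qi] x]; have [q' [q'i ? ? ?]] := partial_iso_back_forth x qi.
  by exists (exist _ q' q'i).
(* Step [n] puts the number [n] into both the domain and the range, so the union is total and
   surjective. *)
pose chain := fix chain n : {q | partial_iso R q} :=
  if n is n'.+1 then f (chain n', n') else exist _ p pi.
have sub n n' : n <= n' -> {subset sval (chain n) <= sval (chain n')}.
  elim: n' => [|n' IH]; first by rewrite leqn0 => /eqP->.
  rewrite leq_eqVlt => /orP[/eqP->//|/IH h] u /h.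
  by have [h' _ _] := fP (chain n', n'); exact: h'.
have /choice[g gP] : forall x, exists y, (x, y) \in sval (chain x.+1).
  move=> x; have [_ /mapP[[a b] /= h e] _] := fP (chain x, x).
  by exists b; move: h; rewrite -e.
(* Two pairs of the union lie in a common partial isomorphism, where either coordinate determines
   the other. *)
have key u v : (exists n, u \in sval (chain n)) -> (exists n, v \in sval (chain n)) ->
    u.1 = v.1 <-> u.2 = v.2.
  move=> [n un] [n' vn].
  have {}un := sub _ _ (leq_maxl n n') _ un.
  have {}vn := sub _ _ (leq_maxr n n') _ vn.
  move: (svalP (chain (maxn n n'))) un vn.
  move: (sval (chain (maxn n n'))) => q qi uq vq.
  have inj (h : nat * nat -> nat) : uniq [seq h u | u <- q] -> h u = h v -> u = v.
    move=> hu e; rewrite -(nth_index (0, 0) uq) -(nth_index (0, 0) vq); congr nth.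
    apply/eqP; rewrite -(nth_uniq 0 _ _ hu) ?size_map ?index_mem//.
    by rewrite !(nth_map (0, 0)) ?index_mem// !nth_index// e.
  by split=> [/(inj fst (pi_uniq1 qi))|/(inj snd (pi_uniq2 qi))] ->.
have gin x : exists n, (x, g x) \in sval (chain n) by exists x.+1.
exists g; split.
- by move=> x y e; apply/(key (x, g x) (y, g y)).
- move=> y; have [_ _ /mapP[[a b] /= h e]] := fP (chain y, y).
  exists a; rewrite e; apply/(key (a, g a) (a, b)) => //.
  by exists y.+1.
- move=> a b c.
  have ha := sub _ _ (leq_maxl a.+1 (maxn b.+1 c.+1)) _ (gP a).
  have hb := sub _ _ (leq_trans (leq_maxl b.+1 c.+1) (leq_maxr a.+1 _)) _ (gP b).
  have hc := sub _ _ (leq_trans (leq_maxr b.+1 c.+1) (leq_maxr a.+1 _)) _ (gP c).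
  exact: (pi_rel (svalP (chain _)) ha hb hc).
move=> u up; apply/(key (u.1, g u.1) u) => //.
by exists 0.
Qed.

End BackAndForth.

(** * Rank, homogeneity and universality of the limit *)

Theorem theorem1p6 :
  exists M : wmatroid,
    [/\ countable [set: M], rank3 M, homogeneous M & universal_for_finite M].
Proof.
have [R [MR R_exhaust R_extend]] := exists_generic_relation.
have [w wP] := exists_wedge R.
pose M := WMatroid MR wP.
have embed (T : Type) (m : nat) (h : T -> nat) (S : T -> T -> T -> Prop) :
    injective h -> h @` setT = `I_m -> simple_matroid S ->
    exists f : T -> nat, [/\ injective f, meet_closed R (f @` setT) &
      forall a b c, S a b c <-> R (f a) (f b) (f c)].
  move=> h_inj h_im MS.
  have hm x : h x < m by have : `I_m (h x) by rewrite -h_im; exact: imageP.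
  have h_inj' x y : setT x -> setT y -> h x = h y -> x = y by move=> _ _; exact: h_inj.
  (* With an empty list nothing is identified, so every finite structure is an extension problem. *)
  have [|g [ginj _ gcl grel]] := R_extend [::] m (image_rel h setT S).
    split=> //.
    - exact: image_rel_matroid.
    - by move=> i j l rl; have [x _ <-] := image_rel_supp rl.
  exists (g \o h); split.
  - by move=> x y /= /ginj e; apply: h_inj; exact: e.
  - by rewrite -image_comp h_im.
  by move=> a b c; rewrite /= -grel// image_relE.
exists M; split.
- exact: (@countableP nat).
(* Rank three is witnessed by an embedded copy of three non-collinear points. *)
- have MS : simple_matroid (fun _ _ _ : 'I_3 => False) by exact: simple_matroid_intro.
  have [|f [f_inj _ fR]] := embed _ 3 (@nat_of_ord 3) _ (@ord_inj 3) _ MS.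
    apply/seteqP; split=> [_ [i _ <-]|i /= hi]; first exact: ltn_ord.
    by exists (Ordinal hi).
  exists (f ord0), (f (@Ordinal 3 1 isT)), (f ord_max); split; last by rewrite /= -fR.
  by split=> /f_inj.
- move=> A B f fgA fgB [[fAB f_inj f_surj] [frel _]].
  have clA : meet_closed R A := finitely_generated_closed fgA.
  have clB : meet_closed R B := finitely_generated_closed fgB.
  have [S [finS eA]] := fgA.
  have [s es] : exists s : seq nat, A = [set` s].
    apply/finite_seqP.
    have /finite_seqP[t et] := finS.
    (* Local finiteness: the generators lie in a finite meet-closed initial segment, which therefore
       contains [A]. *)
    have [k lek clk] := R_exhaust (\max_(y <- t) y.+1).
    apply: (@sub_finite_set _ _ `I_k); last exact: finite_II.
    rewrite eA; apply: smallest_sub; first exact/(@substructureP M).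
    rewrite et => y /= yt; apply: leq_trans lek.
    by rewrite (big_rem y)//= leq_maxl.
  pose p := [seq (x, f x) | x <- undup s].
  have p1 : unzip1 p = undup s by rewrite /unzip1 -map_comp map_id_in.
  have p2 : unzip2 p = [seq f x | x <- undup s] by rewrite /unzip2 -map_comp.
  have inA x : x \in undup s -> A x by rewrite mem_undup es.
  have pi : partial_iso R p.
    split.
    + by rewrite p1 undup_uniq.
    + rewrite p2 map_inj_in_uniq ?undup_uniq// => x y xs ys.
      by apply: f_inj; rewrite inE; exact: inA.
    + rewrite p1; suff -> : [set` undup s] = A by [].
      by rewrite es; apply/seteqP; split=> x /=; rewrite mem_undup.
    + rewrite p2; suff -> : [set` [seq f x | x <- undup s]] = B by [].
      apply/seteqP; split=> [_ /= /mapP[x /inA Ax ->]|y /f_surj[x]].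
        exact: fAB.
      by rewrite es /= => xs <-; apply: map_f; rewrite mem_undup.
    move=> _ _ _ /mapP[a /inA Aa ->] /mapP[b /inA Ab ->] /mapP[c /inA Ac ->] /=.
    exact: frel.
  have [g [g_inj g_surj grel gp]] := partial_iso_extends MR R_exhaust R_extend pi.
  exists g; split; last first.
    move=> x; rewrite es /= => xs; apply: (gp (x, f x)).
    by apply/mapP; exists x; rewrite ?mem_undup.
  split; first split=> //.
  + by move=> x y _ _; exact: g_inj.
  + by move=> y _; have [x <-] := g_surj y; exists x.
  apply: preserves_on_of_rel; [|exact: meet_closedT| |].
  + by move=> x y _ _; exact: g_inj.
  + have -> : g @` [set: M] = setT; last exact: meet_closedT.
    by apply/seteqP; split=> // y _; have [x <-] := g_surj y; exists x.
  + by move=> a b c _ _ _; exact: grel.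
move=> N /finite_setP[m /card_set_bijP[h [hm h_inj h_surj]]].
have [||f [f_inj fcl frel]] := embed N m h (@mrel N) _ _ (mrelP N).
- by move=> x y; apply: h_inj; rewrite inE.
- by apply/seteqP; split=> [_ [x _ <-]|y /h_surj //]; exact: hm.
exists f; split=> //.
apply: preserves_on_of_rel; [|exact: meet_closedT|exact: fcl|].
- by move=> x y _ _; exact: f_inj.
- by move=> a b c _ _ _; exact: frel.
Qed.
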